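(* Let $n \geq 6$ be an integer, let $\pi$ be chosen uniformly at random from the set of permutations of $\{1,2,\dots,n\}$, and let $W = W(\pi)$ be the number of descents of $\pi^{-1}$. Then, with $\mu = \frac{n-1}{2}$ and $\sigma^2 = \frac{n+1}{12}$, $$d_{\mathrm{TV}}\left(\mathcal{L}(W), \mathrm{TP}(\mu,\sigma^2)\right) \leq \sqrt{\frac{23}{5}} \cdot \frac{1}{\sqrt{n+1}} + \frac{24}{n+1}.$$
   Context: A permutation $\tau$ of $\{1,\dots,n\}$ has a descent at position $i$, where $1 \leq i \leq n-1$, if $\tau(i) > \tau(i+1)$; the number of descents of $\tau$ is the number of such $i$. $\mathcal{L}(W)$ denotes the law (distribution) of $W$, and $\mathrm{Po}(\lambda)$ denotes the Poisson distribution with mean $\lambda$. Translated Poisson distribution: an integer-valued random variable $Y$ has the translated Poisson distribution with parameters $\mu$ and $\sigma^2$, written $\mathcal{L}(Y) = \mathrm{TP}(\mu,\sigma^2)$, if $\mathcal{L}(Y - \mu + \sigma^2 + \gamma) = \mathrm{Po}(\sigma^2 + \gamma)$, where $\gamma = \langle \mu - \sigma^2 \rangle$ and $\langle x \rangle = x - \lfloor x \rfloor$ denotes the fractional part of $x$. Total variation distance: for probability distributions $P$ and $Q$ on the integers, $d_{\mathrm{TV}}(P,Q) = \frac{1}{2}\sum_{x \in \mathbb{Z}} |P(x) - Q(x)| = \max_{A \subseteq \mathbb{Z}} |P(A) - Q(A)|$. *)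

(* Defs.v *)
From HB Require Import structures.
From mathcomp Require Import all_boot all_order all_fingroup all_algebra.
From mathcomp Require Import all_classical all_reals all_analysis.
From mathcomp Require Import ring.
Set Implicit Arguments.
Unset Strict Implicit.
Unset Printing Implicit Defensive.
Import Order.TTheory GRing.Theory Num.Theory.
Import numFieldNormedType.Exports.
Local Open Scope classical_set_scope.
Local Open Scope ring_scope.

HB.instance Definition _ := isPointed.Build int 0.

HB.instance Definition _ := @isMeasurable.Build default_measure_display
  int discrete_measurable discrete_measurable0
  discrete_measurableC discrete_measurableU.

HB.instance Definition _ (T : finType) := isPointed.Build (perm_type T) 1%g.

HB.instance Definition _ (T : finType) :=
  @isMeasurable.Build default_measure_display
    (perm_type T) discrete_measurable discrete_measurable0
    discrete_measurableC discrete_measurableU.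

(* The index i : 'I_n stands for the position i + 1; the last index has no
   successor in 'I_n, so it is never counted. *)
Definition descents (n : nat) (s : 'S_n) : nat :=
  #|[pred i : 'I_n | [exists j : 'I_n, (j == i.+1 :> nat) && (s j < s i)%N]]|.

Definition inv_descents (n : nat) (s : 'S_n) : int := (descents s^-1%g)%:Z.

Lemma measurable_inv_descents (n : nat) :
  measurable_fun [set: 'S_n] (@inv_descents n).
Proof. by []. Qed.

HB.instance Definition _ (n : nat) := isMeasurableFun.Build _ _ _ _
  (@inv_descents n) (@measurable_inv_descents n).

Definition uniform_permutation (R : realType) (n : nat) (d : measure_display)
    (Omega : measurableType d) (P : probability Omega R)
    (X : {RV P >-> 'S_n}) : Prop :=
  forall s : 'S_n, distribution P X [set s] = ((n`!)%:R^-1)%:E.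

Definition frac_part (R : realType) (x : R) : R := x - (Num.floor x)%:~R.

(* Q is the law of Y; the laws of the real numbers Y - mu + s2 + gamma and of
   a Poisson variable are compared as measures on the Borel sets of R.
   The nat argument of poisson_prob is not used in its definition. *)
Definition translated_poisson (R : realType) (mu s2 : R)
    (Q : probability int R) : Prop :=
  let gamma := frac_part (mu - s2) in
  forall A : set R, measurable A ->
    pushforward Q (fun y : int => y%:~R - mu + s2 + gamma : R) A =
    pushforward (poisson_prob (s2 + gamma) 0) (fun k : nat => k%:R : R) A.

Definition dTV (R : realType) (P Q : probability int R) : \bar R :=
  ((2^-1)%:E * \esum_(x in [set: int]) `|P [set x] - Q [set x]|)%E.

Lemma translated_poisson_exists (R : realType) (mu s2 : R) :
  exists Q : probability int R, translated_poisson mu s2 Q.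
Proof.
pose m := Num.floor (mu - s2).
pose f (k : nat) : int := k%:Z + m.
have mf : measurable_fun [set: nat] f by [].
pose F : {mfun nat >-> int} := HB.pack f (isMeasurableFun.Build _ _ _ _ f mf).
pose r := s2 + frac_part (mu - s2).
exists (distribution (poisson_prob r 0) F) => gamma A _.
have E k : (f k)%:~R - mu + s2 + gamma = k%:R.
  rewrite /f /gamma /frac_part -/m rmorphD /=.
  by set z := (m%:~R : R); ring.
rewrite /distribution /pushforward /=; congr (poisson_prob _ _ _).
by apply/seteqP; split => k /=; rewrite E.
Qed.

Lemma translated_poisson_unique (R : realType) (mu s2 : R)
    (P Q : probability int R) :
  translated_poisson mu s2 P -> translated_poisson mu s2 Q ->
  forall A : set int, P A = Q A.
Proof.
move=> hP hQ A.
pose g (y : int) : R := y%:~R - mu + s2 + frac_part (mu - s2).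
have gI : injective g.
  by move=> x y; rewrite /g => /addIr/addIr/addIr/eqP; rewrite eqr_int => /eqP.
have mgA : measurable (g @` A).
  apply: countable_measurable; first exact: measurable_set1.
  exact: (sub_countable (card_image_le _ _) (countableP A)).
have gK : g @^-1` (g @` A) = A.
  apply/seteqP; split => x /=; last by move=> Ax; exists x.
  by move=> [y Ay /gI <-].
by have := hP _ mgA; rewrite -(hQ _ mgA) /pushforward gK.
Qed.

(* Main.v *)
Require Import Defs.
From mathcomp Require Import all_boot all_order all_fingroup all_algebra.
From mathcomp Require Import all_classical all_reals all_analysis.
From mathcomp Require Import zify ring lra.
Set Implicit Arguments.
Unset Strict Implicit.
Unset Printing Implicit Defensive.
Import Order.TTheory GRing.Theory Num.Theory.
Import numFieldNormedType.Exports.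
Local Open Scope ring_scope.

(** The number of descents of a uniform permutation satisfies a Stein identity
close to that of a Poisson law.  Since inversion preserves the uniform law, W
may be read as the number of descents of a uniform permutation s of n letters.

Raise a uniformly chosen letter of s to the largest value, keeping the order of
the other letters.  This preserves the uniform law and changes W by -1, 0 or 1:
the letter then ends an ascent and begins a descent.  Stationarity, summed
against a primitive of f, gives

   E[(W - mu) f(W)] = E[T (f(W + 1) - f(W))],

where 2 T is the number U of letters that end and begin an ascent, with a
fictitious smaller letter put before s and another one after it
([stein_identity]).  With f(w) = w - mu this yields Var W = E T = s2.  As U is
essentially a sum of indicators of increasing runs of three consecutive letters,
its variance follows from the probabilities 1/m! of increasing runs of m
letters and from the independence of disjoint runs: Var U = 23 (n + 1) / 180
([variance_half_double_ascents]).

Let m be the floor of mu - s2 and lam = mu - m, so that the translated Poisson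
law is the law of m + Z with Z Poisson of mean lam, and s2 <= lam <= s2 + 1.
For a set A, the Stein equation lam g(j + 1) - j g(j) = 1_A(j) - P(Z in A) has a
solution whose increments are at most 1 / lam ([stein_solution_lipschitz]).
Taking f(w) = g(w - m) in the identity for W bounds
P(W - m in A) - P(Z in A) by E|lam - T| / lam + P(W < m).  The first term is at
most (1 + sqrt (Var T)) / s2, where the 1 pays for lam - s2, and by Chebyshev's
inequality the second one is at most s2 / lam ^ 2 <= 1 / s2
([stein_bound]).  Maximizing over A gives the total variation distance. *)

(** * Descents and the raising of a letter *)

(** Position i is shifted to i + 1 and its value s i to s i + 1, so that 0 can be
the height of the fictitious letters before and after the word. *)
Definition height (n : nat) (s : 'S_n) (g : nat) : nat :=
  if g is i.+1 then oapp (fun x : 'I_n => (s x).+1) 0%N (insub i) else 0%N.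

(** Gap g separates the positions g - 1 and g.  The fictitious letters make gap 0
an ascent and gap n a descent, hence the sum of the falls is one more than the
number of descents. *)
Definition fall (n : nat) (s : 'S_n) (g : nat) : bool :=
  (height s g.+1 < height s g)%N.

Lemma height_ord (n : nat) (s : 'S_n) (i : 'I_n) : height s i.+1 = (s i).+1.
Proof. by rewrite /height valK. Qed.

Lemma height_end (n : nat) (s : 'S_n) : height s n.+1 = 0%N.
Proof. by rewrite /height insubF // ltnn. Qed.

Lemma fall0 (n : nat) (s : 'S_n) : fall s 0 = false.
Proof. by rewrite /fall ltn0. Qed.

Lemma fall_end (n : nat) (s : 'S_n.+1) : fall s n.+1.
Proof. by rewrite /fall height_end (height_ord s ord_max). Qed.

Lemma descents_falls (n : nat) (s : 'S_n.+1) :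
  (descents s).+1 = (\sum_(g < n.+2) fall s g)%N.
Proof.
rewrite big_ord_recl fall0 add0n /descents -sum1_card big_mkcond /=.
rewrite big_ord_recr [in RHS]big_ord_recr /= fall_end addn1.
congr _.+1; rewrite -[RHS]addn0; congr addn; last first.
  case: ifP => // /exists_inP[j /eqP jn _].
  by have := ltn_ord j; rewrite jn ltnn.
apply: eq_bigr => i _; rewrite /bump /= add1n.
have iP : (i.+1 < n.+1)%N by rewrite ltnS.
rewrite /fall (height_ord s (Ordinal iP)).
rewrite (height_ord s (widen_ord (leqnSn n) i)) ltnS.
rewrite inE; case: fintype.existsP => [[j /andP[/eqP ji lt]]|nex].
  have -> : Ordinal iP = j by apply: val_inj; rewrite /= ji.
  by rewrite lt.
case: ltnP => // lt; case: nex; exists (Ordinal iP).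
by rewrite /= eqxx.
Qed.

(** Multiplying s by [raise j] gives the letter of value j the largest value and
moves the larger letters down by one. *)
Definition raise (n : nat) (j : 'I_n.+1) : 'S_n.+1 := lift_perm j ord_max 1.

Lemma raiseE (n : nat) (j x : 'I_n.+1) :
  raise j x = (if x == j then n else x - (j < x))%N :> nat.
Proof.
rewrite /raise; case: (unliftP j x) => [k ->|->]; last by rewrite lift_perm_id eqxx.
rewrite lift_perm_lift perm1 eq_sym (negPf (neq_lift _ _)) lift_max /= /bump.
case: (leqP j k) => jk /=; [rewrite add1n ltnS jk subn1|rewrite add0n ltnNge (ltnW jk) subn0] => //.
Qed.

Section Raising.
Variables (n : nat) (s : 'S_n.+1) (i : 'I_n.+1).
Let s' := (s * raise (s i))%g.

Lemma height_raise (g : nat) : height s' g =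
  (if g == i.+1 then n.+1 else height s g - ((s i).+1 < height s g))%N.
Proof.
case: g => [|g] //=; rewrite eqSS; case: insubP => [x _ xg|] /=; last first.
  by rewrite -leqNgt => ng; rewrite gtn_eqF //; apply: leq_trans (ltn_ord i) ng.
rewrite permM raiseE (inj_eq perm_inj) -xg -(inj_eq val_inj) /= ltnS.
case: eqP => // /eqP xi.
case: (ltnP (s i) (s x)) => //=; lia.
Qed.

Lemma height_inj (g : nat) : g != i.+1 -> height s g != (s i).+1.
Proof.
case: g => [|g] //=; rewrite eqSS; case: insubP => [x _ xg|] //=.
by rewrite -xg eqSS !(inj_eq val_inj) (inj_eq perm_inj).
Qed.

Lemma height_le (g : nat) : (height s g <= n.+1)%N.
Proof. by case: g => [|g] //=; case: insubP => [x _ _|] //=; apply: ltn_ord. Qed.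

Lemma fall_raise (g : nat) : fall s' g =
  if g == i :> nat then false else if g == i.+1 then true else fall s g.
Proof.
rewrite /fall !height_raise eqSS.
have hi := ltn_ord (s i); have hg := height_le g; have hg1 := height_le g.+1.
have ng : g != i.+1 -> height s g != (s i).+1 by apply: height_inj.
have ng1 : g != i -> height s g.+1 != (s i).+1 by rewrite -eqSS; apply: height_inj.
case: (eqVneq g i) ng1 => [gi _|gi /(_ isT) ng1].
  by rewrite gi ltn_eqF //; apply/negbTE; rewrite -leqNgt -gi; lia.
by case: (eqVneq g i.+1) ng => [_ _|gi1 /(_ isT) ng1']; lia.
Qed.

(** The raised letter turns the gap on its left into an ascent and the gap on its
right into a descent; no other gap changes. *)
Lemma descents_raise :
  (descents s' + fall s i + fall s i.+1 = (descents s).+1)%N.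
Proof.
apply: succn_inj; rewrite -!addSn !descents_falls.
have i1 : (i < n.+2)%N by apply: ltnW; apply: (ltn_ord i).
have i2 : (i.+1 < n.+2)%N by rewrite ltnS; apply: (ltn_ord i).
rewrite (bigD1 (Ordinal i1)) // (bigD1 (Ordinal i2)) /=; last first.
  by rewrite -val_eqE /= neq_ltn ltnSn orbT.
rewrite [in RHS](bigD1 (Ordinal i1)) //= [in RHS](bigD1 (Ordinal i2)) /=; last first.
  by rewrite -val_eqE /= neq_ltn ltnSn orbT.
rewrite !fall_raise eqxx (gtn_eqF (ltnSn i)) eqxx.
set X := (\sum_(_ < _ | _) _)%N; set Y := (\sum_(_ < _ | _) _)%N.
have -> : X = Y.
  apply: eq_bigr => g; rewrite -!val_eqE /= => /andP[/negPf gi /negPf gi1].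
  by rewrite fall_raise gi gi1.
by case: (fall s i) (fall s i.+1) => [] []; lia.
Qed.
End Raising.

Section Identity.
Variable R : comPzRingType.

Definition double_ascent (n : nat) (s : 'S_n) (i : nat) : R :=
  (~~ fall s i && ~~ fall s i.+1)%:R.

(** Choosing the letter by its value j makes each move s |-> s * raise j a
bijection, so the sum of F(W) over all permutations is unchanged on average, for
every F.  Take F with increments f.  If a and b are the indicators of falls at
the two gaps around the letter, then the increment of F(W) is f(W + 1) for
a = b = 0, - f(W) for a = b = 1 and 0 otherwise; the sum over the letters of
1 - a - b is n - 2 W for n + 1 letters. *)
Lemma stein_identity (n : nat) (f : nat -> R) :
  \sum_(s : 'S_n.+1) (\sum_(i < n.+1) double_ascent s i) *
     (f (descents s).+1 - f (descents s)) =
  \sum_(s : 'S_n.+1) ((descents s)%:R *+ 2 - n%:R) * f (descents s).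
Proof.
(* A primitive of f: F (w + 1) - F w = f (w + 1). *)
pose F w := \sum_(i < w.+1) f i.
have FS w : F w.+1 = F w + f w.+1 by rewrite /F big_ord_recr.
have stat : \sum_(s : 'S_n.+1) \sum_(i < n.+1)
    (F (descents (s * raise (s i))%g) - F (descents s)) = 0.
  under eq_bigr => s _ do rewrite (reindex_inj (@perm_inj _ (s^-1)%g)) /=.
  rewrite exchange_big /= big1 // => j _.
  under eq_bigr => s _ do rewrite permKV.
  rewrite sumrB; apply/eqP; rewrite subr_eq0; apply/eqP.
  by rewrite [RHS](reindex_inj (mulIg (raise j))).
apply/eqP; rewrite -subr_eq0; apply/eqP; rewrite -[RHS]stat -sumrB.
apply: eq_bigr => s _; set w := descents s.
have step (i : 'I_n.+1) : F (descents (s * raise (s i))%g) - F w =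
    double_ascent s i * (f w.+1 - f w) + (1 - (fall s i)%:R - (fall s i.+1)%:R) * f w.
  rewrite /double_ascent; have := descents_raise s i; rewrite -/w.
  case: (fall s i) (fall s i.+1) => [] [] /=; rewrite ?addn1 ?addn0.
  - by move=> [<-]; rewrite FS; ring.
  - by move=> [->]; ring.
  - by move=> [->]; ring.
  - by move=> ->; rewrite FS; ring.
under [RHS]eq_bigr => i _ do rewrite step.
rewrite big_split /= -!mulr_suml; congr (_ + _); rewrite -mulNr; congr (_ * _).
rewrite !sumrB.
have d := descents_falls s; rewrite -/w in d.
have l : (\sum_(i < n.+1) fall s i = w)%N.
  by move: d; rewrite big_ord_recr /= fall_end addn1 => -[].
have r : (\sum_(i < n.+1) fall s i.+1 = w.+1)%N.
  by rewrite d [RHS]big_ord_recl fall0 add0n.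
rewrite -!natr_sum l r sumr_const card_ord; ring.
Qed.
End Identity.

(** * Probabilities of increasing runs *)

Definition increasing_on (n : nat) (B : {set 'I_n}) (s : 'S_n) : bool :=
  [forall x in B, forall y in B, (x < y)%N ==> (s x < s y)%N].

Lemma increasing_onP (n : nat) (B : {set 'I_n}) (s : 'S_n) :
  reflect {in B &, forall x y : 'I_n, (x < y)%N -> (s x < s y)%N}
    (increasing_on B s).
Proof.
apply: (iffP forall_inP) => [H x y xB yB|H x xB].
  by move/forall_inP: (H x xB) => /(_ y yB)/implyP.
by apply/forall_inP => y yB; apply/implyP; apply: H.
Qed.

(** By the rearrangement inequality, an arrangement of the values of s on B that
maximizes the sum of x * s (t x) is increasing on B. *)
Lemma sorting_exists (n : nat) (B : {set 'I_n}) (s : 'S_n) :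
  exists2 t : 'S_n, perm_on B t & increasing_on B (t * s)%g.
Proof.
pose weight (t : 'S_n) := (\sum_(x < n) x * s (t x))%N.
have [t tB tmax] := @arg_maxnP _ 1%g (perm_on B) weight (perm_on1 B).
exists t => //; apply/increasing_onP => x y xB yB xy; rewrite !permM ltnNge.
apply/negP => le; have xNy : y != x by rewrite -val_eqE /= gtn_eqF.
have ne : s (t x) != s (t y) :> nat.
  by rewrite val_eqE !(inj_eq perm_inj) eq_sym.
have swapB : perm_on B (tperm x y * t)%g.
  apply: perm_onM => //; apply/fintype.subsetP => z; rewrite inE.
  by case: tpermP => [-> _|-> _|_ _]; rewrite ?eqxx.
have : (weight (tperm x y * t)%g <= weight t)%N by apply: tmax.
rewrite leqNgt => /negP; apply.
have split (u : 'S_n) : weight u =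
    (x * s (u x) + (y * s (u y) + \sum_(z < n | (z != x) && (z != y)) z * s (u z)))%N.
  by rewrite /weight (bigD1 x) //= (bigD1 y).
rewrite !split !permM tpermL tpermR.
under [in X in (_ < X)%N]eq_bigr => z /andP[zx zy] do
  rewrite permM tpermD 1?eq_sym //.
set A := (\sum_(_ < _ | _) _)%N; rewrite !addnA ltn_add2r.
move: ne le xy; move: (s (t x) : nat) (s (t y) : nat) (x : nat) (y : nat).
by move=> a b c d; nia.
Qed.

(** In an arrangement increasing on B, the rank of the value at x among the values
of s on B is the rank of x in B, so that this value is determined. *)
Lemma sorting_unique (n : nat) (B : {set 'I_n}) (s t u : 'S_n) :
  perm_on B t -> perm_on B u ->
  increasing_on B (t * s)%g -> increasing_on B (u * s)%g -> t = u.
Proof.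
pose C (t : 'S_n) x := [set z in B | (s z < s (t x))%N].
have rank (v : 'S_n) x : perm_on B v -> increasing_on B (v * s)%g -> x \in B ->
    #|C v x| = #|[set y in B | (y < x)%N]|.
  move=> vB /increasing_onP inc xB.
  rewrite -[RHS](card_imset _ (@perm_inj _ v)); apply: eq_card => z.
  apply/idP/imsetP => [|[y]]; rewrite !inE.
    move=> /andP[zB lt]; exists (v^-1 z)%g; last by rewrite permKV.
    have zB' : (v^-1 z)%g \in B by rewrite -(perm_closed _ vB) permKV.
    rewrite inE zB' /= ltnNge leq_eqVlt; apply/negP => /orP[/eqP/val_inj xz|xz].
      by move: lt; rewrite xz permKV ltnn.
    have := inc _ _ xB zB' xz; rewrite !permM permKV => /(ltn_trans lt).
    by rewrite ltnn.
  move=> /andP[yB yx] ->; rewrite (perm_closed _ vB) yB /=.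
  by have := inc _ _ yB xB yx; rewrite !permM.
move=> tB uB tinc uinc; apply/permP => x.
have [xB|xB] := boolP (x \in B); last by rewrite !(out_perm _ xB).
have sub (v w : 'S_n) : (s (v x) < s (w x))%N -> v x \in B -> (#|C v x| < #|C w x|)%N.
  move=> lt vxB; apply: proper_card; apply/fintype.properP; split.
    apply/fintype.subsetP => z; rewrite !inE => /andP[-> /=] /ltn_trans; exact.
  by exists (v x); rewrite !inE vxB ?lt // ltnn.
have e : #|C t x| = #|C u x| by rewrite !rank.
apply/(@perm_inj _ s)/val_inj/eqP; rewrite eqn_leq; apply/andP; split;
  rewrite leqNgt; apply/negP => /sub; rewrite (perm_closed _ _) //.
  by move=> /(_ xB); rewrite e ltnn.
by move=> /(_ xB); rewrite e ltnn.
Qed.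

(** Average over the #|B|! arrangements of the values on B, exactly one of which is
increasing: being increasing on B is independent of every statistic that does
not see the order on B. *)
Lemma sum_increasing_on (V : pzSemiRingType) (n : nat) (B : {set 'I_n}) (h : 'S_n -> V) :
  (forall t s, perm_on B t -> h (t * s)%g = h s) ->
  (\sum_s (increasing_on B s)%:R * h s) *+ (#|B|)`! = \sum_s h s.
Proof.
move=> hB; rewrite -(card_perm B).
transitivity (\sum_(t | perm_on B t) \sum_s (increasing_on B (t * s)%g)%:R * h s).
  rewrite -sumr_const; apply: eq_bigr => t tB.
  rewrite [LHS](reindex_inj (mulgI t)) /=.
  by apply: eq_bigr => s _; rewrite hB.
rewrite exchange_big /=; apply: eq_bigr => s _; rewrite -mulr_suml.
have [t tB tinc] := sorting_exists B s.
rewrite (bigD1 t) //= tinc big1 ?addr0 ?mul1r // => u /andP[uB /eqP ut].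
by case: (boolP (increasing_on _ _)) => // /(sorting_unique tB uB tinc)/esym.
Qed.

(** Counted in gaps: [run a l] spans l + 1 letters, from position a - 1 on. *)
Definition run (n : nat) (a l : nat) (s : 'S_n) : bool :=
  all (fun g => ~~ fall s g) (iota a l).

Definition block (n a l : nat) : {set 'I_n} := [set x : 'I_n | (a <= x <= a + l)%N].

Lemma card_block (n a l : nat) : (a + l < n)%N -> #|block n a l| = l.+1.
Proof.
move=> aln; have lt (k : 'I_l.+1) : (a + k < n)%N by have := ltn_ord k; lia.
rewrite -[RHS]card_ord -cardsT -(card_imset [set: 'I_l.+1] (f := fun k => Ordinal (lt k))).
  apply: eq_card => x; apply/idP/imsetP => [|[k _ ->]]; rewrite inE /=.
    move=> /andP[ax xl]; have kl : (x - a < l.+1)%N by lia.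
    by exists (Ordinal kl); rewrite ?inE //; apply: val_inj; rewrite /= subnKC.
  by have := ltn_ord k; lia.
by move=> k k' [] /addnI/val_inj.
Qed.

Lemma fall_ord (n : nat) (s : 'S_n) (x y : 'I_n) : y = x.+1 :> nat ->
  ~~ fall s x.+1 = (s x < s y)%N.
Proof.
move=> yx; rewrite /fall height_ord -yx height_ord -leqNgt ltnS leq_eqVlt.
rewrite val_eqE (inj_eq perm_inj) -val_eqE /= yx ltn_eqF //.
Qed.

Lemma run_increasing (n a l : nat) (s : 'S_n) : (a + l < n)%N ->
  run a.+1 l s = increasing_on (block n a l) s.
Proof.
move=> aln; apply/allP/increasing_onP => [H x y|H g]; last first.
  rewrite mem_iota => /andP[]; case: g => // g; rewrite ltnS addSn ltnS => ag gl.
  have gn : (g.+1 < n)%N by lia.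
  rewrite (@fall_ord n s (Ordinal (ltnW gn)) (Ordinal gn)) //.
  by apply: H; rewrite ?inE //=; lia.
rewrite !inE => /andP[ax _] /andP[_ yal] xy.
have [d dE] : exists d, (x + d.+1 = y)%N by exists (y - x.+1)%N; lia.
elim: d y {xy} dE yal => [|d IH] y dE yal.
  rewrite -fall_ord ?H // ?mem_iota; lia.
have zn : (x + d.+1 < n)%N by have := ltn_ord y; lia.
apply: (ltn_trans (IH (Ordinal zn) _ _)) => //=; first by lia.
by rewrite -(@fall_ord n s (Ordinal zn) y) ?H //= ?mem_iota; lia.
Qed.

Lemma run_perm_on (n a l b k : nat) (t s : 'S_n) : (a + l < b)%N ->
  perm_on (block n a l) t -> run b.+1 k (t * s)%g = run b.+1 k s.
Proof.
move=> alb tB; have e g : (b < g)%N -> height (t * s)%g g = height s g.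
  case: g => [|g] //= bg; case: insubP => //= x _ xg.
  by rewrite permM (out_perm tB) // inE; lia.
apply: eq_in_all => g; rewrite mem_iota => /andP[bg _].
by rewrite /fall !e //; lia.
Qed.

Section Mean.
Variables (R : realFieldType) (n : nat).

Definition mean (h : 'S_n -> R) : R := (\sum_s h s) / n`!%:R.

Lemma meanD h k : mean (fun s => h s + k s) = mean h + mean k.
Proof. by rewrite /mean big_split mulrDl. Qed.

Lemma meanZ c h : mean (fun s => c * h s) = c * mean h.
Proof. by rewrite /mean -mulr_sumr mulrA. Qed.

Lemma mean_sum (I : Type) (r : seq I) (P : pred I) (h : I -> 'S_n -> R) :
  mean (fun s => \sum_(i <- r | P i) h i s) = \sum_(i <- r | P i) mean (h i).
Proof. by rewrite /mean exchange_big mulr_suml. Qed.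

Lemma eq_mean h k : h =1 k -> mean h = mean k.
Proof. by move=> hk; rewrite /mean (eq_bigr k). Qed.

Lemma fact_neq0 m : m`!%:R != 0 :> R.
Proof. by rewrite pnatr_eq0 -lt0n fact_gt0. Qed.

Lemma mean_cst c : mean (fun=> c) = c.
Proof.
by rewrite /mean sumr_const card_Sn -[X in X / _]mulr_natr mulfK ?fact_neq0.
Qed.

Lemma le_mean h k : (forall s, h s <= k s) -> mean h <= mean k.
Proof.
by move=> hk; rewrite ler_pM2r ?ler_sum // invr_gt0 ltr0n fact_gt0.
Qed.

Lemma mean_run_indep (a l : nat) (h : 'S_n -> R) : (a + l < n)%N ->
  (forall t s, perm_on (block n a l) t -> h (t * s)%g = h s) ->
  mean (fun s => (run a.+1 l s)%:R * h s) = mean h / l.+1`!%:R.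
Proof.
move=> aln hB; rewrite /mean -(sum_increasing_on hB) card_block //.
under eq_bigr => s _ do rewrite run_increasing //.
rewrite -[X in _ = X / _ / _]mulr_natr; field.
by rewrite !fact_neq0.
Qed.

Lemma mean_run (a l : nat) : (a + l < n)%N ->
  mean (fun s => (run a.+1 l s)%:R) = (l.+1`!%:R)^-1.
Proof.
move=> aln; rewrite -[RHS]mul1r -[X in X / _]mean_cst -(mean_run_indep aln) //.
by apply: eq_mean => s; rewrite mulr1.
Qed.

Lemma mean_run2 (a l b k : nat) : (a + l < b)%N -> (b + k < n)%N ->
  mean (fun s => (run a.+1 l s)%:R * (run b.+1 k s)%:R) =
  (k.+1`!%:R)^-1 / l.+1`!%:R.
Proof.
move=> alb bkn; rewrite mean_run_indep ?mean_run //; first by lia.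
by move=> t s tB; rewrite (run_perm_on _ _ alb).
Qed.
End Mean.

(** * Variance of the number of double ascents *)

Section Moments.
Variables (R : realFieldType) (n : nat).
Implicit Type s : 'S_n.
Let X (i : nat) s : R := double_ascent R s i.

Lemma double_ascent0 s : X 0 s = (run 1 1 s)%:R.
Proof. by rewrite /X /double_ascent /run fall0 /= andbT. Qed.

Lemma double_ascentS i s : X i.+1 s = (run i.+1 2 s)%:R.
Proof. by rewrite /X /double_ascent /run /= andbT. Qed.

Lemma mean_double_ascent0 : (1 < n)%N -> mean (X 0) = 1 / 2.
Proof.
by move=> n1; rewrite (eq_mean double_ascent0) mean_run // div1r.
Qed.

Lemma mean_double_ascent i : (i.+2 < n)%N -> mean (X i.+1) = 1 / 6.
Proof.
by move=> n1; rewrite (eq_mean (double_ascentS i)) mean_run ?addn2 // div1r.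
Qed.

Lemma mean_run_cat a l b k c m : (a + m < n)%N ->
  (forall s, run b.+1 k s && run c.+1 l s = run a.+1 m s) ->
  mean (fun s => (run b.+1 k s)%:R * (run c.+1 l s)%:R) = (m.+1`!%:R)^-1 :> R.
Proof.
move=> am h; rewrite -(mean_run R am); apply: eq_mean => s.
by rewrite -natrM mulnb h.
Qed.

(** A double ascent is an increasing run of three letters, except at position 0
where the letter before is fictitious and two letters remain.  Pairs at distance
at most 2 share letters and merge into one run; the others are independent. *)
Lemma mean_double_ascent_pair (i d : nat) : (i + d.+2 < n)%N ->
  mean (fun s => X i s * X (i + d.+1) s) =
  match i, d with
  | 0, 0 => 1 / 6 | 0, 1 => 1 / 24 | 0, _ => 1 / 12
  | _, 0 => 1 / 24 | _, 1 => 1 / 120 | _, _ => 1 / 36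
  end.
Proof.
case: i => [|i]; case: d => [|[|d]] idn;
  (under [LHS]eq_mean => s do rewrite ?double_ascent0 ?addSn ?add0n !double_ascentS).
- rewrite (@mean_run_cat 0 _ _ _ _ 2) ?div1r // => s; rewrite /run /=; lia.
- rewrite (@mean_run_cat 0 _ _ _ _ 3) ?div1r // => s; rewrite /run /=; lia.
- rewrite mean_run2 //; last by lia.
  by rewrite !factS fact0 /=; field.
- rewrite (@mean_run_cat i _ _ _ _ 3) ?div1r //; first by lia.
  by move=> s; rewrite /run /= ?addn1; lia.
- rewrite (@mean_run_cat i _ _ _ _ 4) ?div1r //; first lia.
  move=> s; rewrite /run /= ?addn2; lia.
- rewrite mean_run2 //; try lia.
  by rewrite !factS fact0 /=; field.
Qed.

Let S (k : nat) s : R := \sum_(i < k) X i s.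

Lemma mean_double_ascents k : (k.+1 < n)%N -> mean (S k.+1) = (k%:R + 3) / 6.
Proof.
move=> kn; rewrite /S mean_sum big_ord_recl mean_double_ascent0; last by lia.
rewrite (eq_bigr (fun=> 1 / 6)) => [|i _]; last first.
  by rewrite mean_double_ascent //; apply: leq_ltn_trans kn; apply: (ltn_ord i).
by rewrite sumr_const card_ord -[_ *+ k]mulr_natr; field.
Qed.

(** The first term and the last two deviate from the generic value 1 / 36 of
independent triples: they are 1 / 12, 1 / 120 and 1 / 24. *)
Lemma mean_double_ascents_next k : (k + 4 < n)%N ->
  mean (fun s => S (k + 3) s * X (k + 3) s) = k%:R / 36 + 1 / 12 + 1 / 20.
Proof.
move=> kn; rewrite /S.
under eq_mean => s do rewrite mulr_suml.
rewrite mean_sum addn3 2!big_ord_recr big_ord_recl /=.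
rewrite (@mean_double_ascent_pair 0 k.+2) /=; last by lia.
rewrite (_ : k.+3 = k.+1 + 2)%N; last by lia.
rewrite (@mean_double_ascent_pair k.+1 1) /=; last by lia.
rewrite (_ : k.+1 + 2 = k.+2 + 1)%N; last by lia.
rewrite (@mean_double_ascent_pair k.+2 0) /=; last by lia.
rewrite (eq_bigr (fun=> 1 / 36)) => [|i _]; last first.
  have ik := ltn_ord i.
  rewrite (_ : k.+2 + 1 = (bump 0 i) + (k - i).+1.+1)%N; last by rewrite /bump; lia.
  rewrite mean_double_ascent_pair; last by rewrite /bump; lia.
  by rewrite (_ : k - i = (k - i.+1).+1)%N //; lia.
by rewrite sumr_const card_ord -[_ *+ k]mulr_natr; field.
Qed.

(** The square of the partial sum is expanded one term at a time: its increment is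
twice the correlation with the next term plus the mean of that term, which is an
indicator. *)
Lemma mean_sqr_double_ascents k : (k + 4 <= n)%N ->
  mean (fun s => S (k + 3) s ^+ 2) = 23 * (k%:R + 5) / 180 + (k%:R + 5) ^+ 2 / 36.
Proof.
have XX i s : X i s ^+ 2 = X i s by rewrite /X /double_ascent -natrX; case: andb.
have step j : mean (fun s => S j.+1 s ^+ 2) =
    mean (fun s => S j s ^+ 2) + 2 * mean (fun s => S j s * X j s) + mean (X j).
  rewrite -meanZ -!meanD; apply: eq_mean => s.
  by rewrite /S big_ord_recr /= sqrrD XX; ring.
elim: k => [|k IH] kn.
  rewrite add0n step step step.
  have -> : mean (fun s => S 0 s ^+ 2) = 0.
    by rewrite -[RHS](mean_cst n 0); apply: eq_mean => s; rewrite /S big_ord0 expr0n.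
  have -> : mean (fun s => S 0 s * X 0 s) = 0.
    by rewrite -[RHS](mean_cst n 0); apply: eq_mean => s; rewrite /S big_ord0 mul0r.
  have -> : mean (fun s => S 1 s * X 1 s) = 1 / 6.
    under eq_mean => s do rewrite /S big_ord1.
    by rewrite (@mean_double_ascent_pair 0 0) //; lia.
  have -> : mean (fun s => S 2 s * X 2 s) = 1 / 12.
    under eq_mean => s do rewrite /S big_ord_recr big_ord1 /= mulrDl.
    rewrite meanD (@mean_double_ascent_pair 0 1) ?(@mean_double_ascent_pair 1 0) /=; try lia.
    by field.
  rewrite mean_double_ascent0 ?mean_double_ascent; try lia.
  by field.
rewrite addSn step IH; last by lia.
rewrite mean_double_ascents_next; last by lia.
rewrite addn3 mean_double_ascent; last by lia.
by rewrite -natr1; field.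
Qed.
End Moments.

Section Variance.
Variables (R : realFieldType) (n : nat).
Hypothesis n3 : (3 <= n)%N.
Let U (s : 'S_n.+1) : R := \sum_(i < n.+1) double_ascent R s i.

Lemma last_double_ascent (s : 'S_n.+1) : double_ascent R s n = 0.
Proof. by rewrite /double_ascent fall_end andbF. Qed.

Lemma mean_half_double_ascents : mean (fun s => U s / 2) = (n%:R + 2) / 12.
Proof.
under eq_mean => s do rewrite /U big_ord_recr /= last_double_ascent addr0 mulrC.
rewrite meanZ; case: n n3 => // k k2; rewrite mean_double_ascents //.
by rewrite -natr1; field.
Qed.

Lemma variance_half_double_ascents :
  mean (fun s => (U s / 2 - (n%:R + 2) / 12) ^+ 2) = 23 * (n%:R + 2) / 720.
Proof.
have [k kE] : exists k, (k + 3 = n)%N by exists (n - 3)%N; lia.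
have kR : k%:R + 3 = n%:R :> R by rewrite -kE natrD.
have e s : (U s / 2 - (n%:R + 2) / 12) ^+ 2 =
    1 / 4 * (\sum_(i < n) double_ascent R s i) ^+ 2
    + (- ((n%:R + 2) / 6) * (U s / 2) + ((n%:R + 2) / 12) ^+ 2).
  by rewrite /U big_ord_recr /= last_double_ascent addr0; field.
rewrite (eq_mean e) !meanD !meanZ mean_cst mean_half_double_ascents.
have -> : mean (fun s : 'S_n.+1 => (\sum_(i < n) double_ascent R s i) ^+ 2) =
    23 * (n%:R + 2) / 180 + (n%:R + 2) ^+ 2 / 36.
  have kn : (k + 4 <= n.+1)%N by lia.
  by have := mean_sqr_double_ascents R kn; rewrite kE => ->; rewrite -kR; field.
by field.
Qed.
End Variance.

Local Open Scope classical_set_scope.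
Local Open Scope ring_scope.

(** * The Stein equation of a Poisson law *)

Section PoissonStein.
Variables (R : realType) (lam : R).
Hypothesis lam0 : 0 < lam.
Let p (k : nat) : R := poisson_pmf lam k.
Let P (k : nat) : R := \sum_(i < k) p i.

Lemma poisson_pmf_gt0 k : 0 < p k.
Proof.
rewrite /p /poisson_pmf lam0 mulr_gt0 ?expR_gt0 // mulr_gt0 ?exprn_gt0 //.
Qed.

Lemma poisson_pmfS k : p k.+1 = lam * p k / k.+1%:R.
Proof.
rewrite /p /poisson_pmf lam0 factS natrM exprS; field.
by rewrite nat1r !pnatr_eq0 -!lt0n fact_gt0.
Qed.

Lemma poisson_partial_cvg : P n @[n --> \oo] --> (1 : R).
Proof.
have := @is_cvg_series_exp_coeff R lam => /cvg_ex[/= l hl].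
have le : l = expR lam by apply/esym; exact: (cvg_lim (@Rhausdorff R) hl).
have -> : P = (fun n => expR (- lam) * series (exp_coeff lam) n).
  apply/funext => n; rewrite /P /series /= big_mkord mulr_sumr.
  by apply: eq_bigr => i _; rewrite /p /poisson_pmf lam0 /exp_coeff mulrC.
rewrite -[X in _ --> X](_ : expR (- lam) * l = 1); first exact: cvgMr.
by rewrite le -expRD addNr expR0.
Qed.

Lemma poisson_partial_le1 n : P n <= 1.
Proof.
have nd : nondecreasing_seq P.
  apply/nondecreasing_seqP => k; rewrite /P big_ord_recr /= lerDl.
  exact/ltW/poisson_pmf_gt0.
have := nondecreasing_cvgn_le nd (cvgP _ poisson_partial_cvg) n.
by rewrite (cvg_lim (@Rhausdorff R) poisson_partial_cvg).
Qed.

Lemma poisson_log_concave i k : (i <= k)%N -> p i * p k.+1 <= p i.+1 * p k.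
Proof.
move=> ik; rewrite !poisson_pmfS.
have -> : p i * (lam * p k / k.+1%:R) = (lam * p i * p k) * k.+1%:R^-1 by ring.
have -> : lam * p i / i.+1%:R * p k = (lam * p i * p k) * i.+1%:R^-1 by ring.
apply: ler_wpM2l; first by rewrite !mulr_ge0 ?ltW ?poisson_pmf_gt0.
by rewrite lef_pV2 ?posrE ?ltr0n // ler_nat ltnS.
Qed.

(** By log-concavity, the ratio of the head of the law to its last term
is nondecreasing. *)
Lemma poisson_head k : P k.+1 * p k.+1 <= P k.+2 * p k.
Proof.
rewrite /P [X in _ <= X * _]big_ord_recl mulrDl.
rewrite -[X in X <= _]add0r lerD //; first by rewrite mulr_ge0 ?ltW ?poisson_pmf_gt0.
rewrite !mulr_suml; apply: ler_sum => i _.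
by apply: poisson_log_concave; rewrite -ltnS; apply: ltn_ord.
Qed.

(** By log-concavity again, the ratio of the tail to the term before it
is nonincreasing.  The inequality holds between truncated tails, hence in the
limit. *)
Lemma poisson_tail k : p k * (1 - P k.+2) <= p k.+1 * (1 - P k.+1).
Proof.
have fin n : p k * (P (k.+2 + n) - P k.+2) <= p k.+1 * (P (k.+1 + n) - P k.+1).
  elim: n => [|n IH]; first by rewrite !addn0 !subrr !mulr0.
  rewrite !addnS /P big_ord_recr [X in _ <= _ * (X - _)]big_ord_recr /=.
  rewrite -/(P _) -/(P _) -/(P _) -/(P _).
  have := @poisson_log_concave k (k.+1 + n) _; rewrite !addSn in IH *.
  by move=> /(_ ltac:(lia)); lra.
have pk := poisson_pmf_gt0 k.
rewrite -ler_pdivlMl // lerBlDr.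
have {1}<- := cvg_lim (@Rhausdorff R) poisson_partial_cvg.
apply: limr_le; first by apply: cvgP; exact: poisson_partial_cvg.
exists k.+2 => //= n kn.
rewrite -lerBlDr ler_pdivlMl // -[n](subnKC kn).
apply: le_trans (fin _) _; rewrite ler_pM2l ?poisson_pmf_gt0 // lerB //.
exact: poisson_partial_le1.
Qed.

Variables (A : pred nat) (N : nat).
Hypothesis AN : forall k, A k -> (k < N)%N.
Let a (n : nat) : R := \sum_(i < n | A i) p i.

Definition poisson_mass : R := a N.

(** The Stein equation solved forward from 0.  The value 0 at 0 makes the extension
by 0 to the negative integers, needed when W < m, keep the increments bounded. *)
Definition stein_solution (n : nat) : R :=
  if n is k.+1 then (a k.+1 - poisson_mass * P k.+1) / (lam * p k) else 0.

Let aS n : a n.+1 = a n + (A n)%:R * p n.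
Proof.
by rewrite /a big_mkcond big_ord_recr -big_mkcond /=; case: A; rewrite ?mul1r ?mul0r.
Qed.

Lemma sub_mass n : 0 <= poisson_mass - a n <= 1 - P n.
Proof.
have step m d : 0 <= a (m + d) - a m <= P (m + d) - P m.
  elim: d => [|d /andP[IH0 IH1]]; first by rewrite addn0 !subrr lexx.
  have := poisson_pmf_gt0 (m + d).
  rewrite addnS aS /P big_ord_recr /= -/(P _) -/(P _).
  by case: (A _) => /=; lra.
have [nN|Nn] := leqP n N.
  have := step n (N - n)%N; have := poisson_partial_le1 N.
  by rewrite subnKC // /poisson_mass => h /andP[-> /=]; lra.
have -> : a n = poisson_mass.
  rewrite /poisson_mass -(subnKC (ltnW Nn)); elim: (n - N)%N => [|d IH].
    by rewrite addn0.
  rewrite addnS aS IH; case: (boolP (A _)) => [/AN|_]; last by rewrite mul0r addr0.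
  by rewrite ltnNge leq_addr.
by rewrite subrr lexx subr_ge0 poisson_partial_le1.
Qed.

Lemma stein_equation j :
  lam * stein_solution j.+1 - j%:R * stein_solution j = (A j)%:R - poisson_mass.
Proof.
have pj := lt0r_neq0 (poisson_pmf_gt0 j); have l0 := lt0r_neq0 lam0.
have PS n : P n.+1 = P n + p n by rewrite /P big_ord_recr.
have -> : j%:R * stein_solution j = (a j - poisson_mass * P j) / p j.
  case: j pj => [|j] pj; first by rewrite /a /P !big_ord0 mul0r mulr0 subrr mul0r.
  have pj' := lt0r_neq0 (poisson_pmf_gt0 j).
  rewrite /stein_solution poisson_pmfS; field.
  by rewrite pj' l0 nat1r pnatr_eq0.
by rewrite /= aS PS; field; rewrite pj l0.
Qed.

(** Split A into its parts below, at and above j.  The parts below and above j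
contribute nonpositive increments, by [poisson_tail] and [poisson_head].  The
solutions for the whole of the natural numbers vanish, so the contribution M of
the point j compensates exactly those of all the other points; thus the
increment lies between -M and M, and M <= 1 / lam by [poisson_head]. *)
Lemma stein_solution_lipschitz j :
  `|stein_solution j.+1 - stein_solution j| <= lam^-1.
Proof.
have l0 := lt0r_neq0 lam0.
have PS n : P n.+1 = P n + p n by rewrite /P big_ord_recr.
have a0 : a 0 = 0 by rewrite /a big_ord0.
have P0 : P 0 = 0 by rewrite /P big_ord0.
suff : `|lam * (stein_solution j.+1 - stein_solution j)| <= 1.
  by rewrite normrM gtr0_norm // -[X in _ -> _ <= X]mulr1 ler_pdivlMl.
case: j => [|k].
  have := sub_mass 0; rewrite a0 P0 => /andP[m0 m1].
  rewrite /stein_solution aS PS a0 P0.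
  have -> : lam * ((0 + (A 0)%:R * p 0 - poisson_mass * (0 + p 0)) / (lam * p 0) - 0)
     = (A 0)%:R - poisson_mass.
    by field; rewrite l0 lt0r_neq0 ?poisson_pmf_gt0.
  by rewrite ler_norml; case: (A 0) => /=; lra.
have := poisson_tail k; have := poisson_head k.
have := sub_mass k.+2; have a0' : 0 <= a k.+1.
  by apply: sumr_ge0 => i _; exact/ltW/poisson_pmf_gt0.
have aP : a k.+1 <= P k.+1.
  rewrite /a big_mkcond; apply: ler_sum => i _; case: ifP => // _.
  exact/ltW/poisson_pmf_gt0.
rewrite /stein_solution (aS k.+1) (PS k.+1) => /andP[].
have x0 := poisson_pmf_gt0 k; have y0 := poisson_pmf_gt0 k.+1.
have b01 : 0 <= ((A k.+1)%:R : R) <= 1 by case: (A _); rewrite /= ?lexx ?ler01.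
move: (p k) (p k.+1) (P k.+1) (a k.+1) poisson_mass ((A k.+1)%:R : R) x0 y0 b01 a0' aP.
move=> x y Q b m t x0 y0 /andP[t0 t1] b0 bQ mc cQ head tail.
have x0' := lt0r_neq0 x0; have y0' := lt0r_neq0 y0.
pose al := (1 - Q) / x - (1 - Q - y) / y.
pose be := (Q + y) / y - Q / x.
have al0 : 0 <= al.
  by rewrite subr_ge0 ler_pdivrMr // mulrAC ler_pdivlMr //; lra.
have be0 : 0 <= be.
  by rewrite subr_ge0 ler_pdivrMr // mulrAC ler_pdivlMr //; lra.
pose M := Q * al + (1 - Q - y) * be.
have ME : M = 1 - y * be by rewrite /M /al /be; field; rewrite x0' y0'.
have -> : lam * ((b + t * y - m * (Q + y)) / (lam * y) - (b - m * Q) / (lam * x)) =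
    t * M - (b * al + (m - (b + t * y)) * be).
  by rewrite /M /al /be; field; rewrite x0' y0' l0.
have h1 : 0 <= b * al <= Q * al by rewrite mulr_ge0 // ler_wpM2r.
have h2 : 0 <= (m - (b + t * y)) * be <= (1 - Q - y) * be.
  by rewrite mulr_ge0 // ler_wpM2r //; lra.
have M0 : 0 <= M by move: h1 h2; rewrite /M; lra.
have M1 : M <= 1 by rewrite ME lerBlDr lerDl mulr_ge0 // ltW.
have h3 : 0 <= t * M <= M by rewrite mulr_ge0 // ler_piMl.
have MM : M = Q * al + (1 - Q - y) * be by [].
move: h1 h2 h3 M1 MM; clearbody M.
move: (b * al) (Q * al) (_ * be) (_ * be) (t * M) => u1 u2 u3 u4 u5.
by move=> /andP[? ?] /andP[? ?] /andP[? ?] ? ?; rewrite ler_norml; apply/andP; split; lra.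
Qed.
End PoissonStein.

(** * Comparison of descents with a Poisson variable *)

Section SteinBound.
Variables (R : realType) (n : nat).
Hypothesis n3 : (3 <= n)%N.
Let mu : R := n%:R / 2.
Let s2 : R := (n%:R + 2) / 12.
Let T (s : 'S_n.+1) : R := (\sum_(i < n.+1) double_ascent R s i) / 2.
Let W (s : 'S_n.+1) : nat := descents s.

Lemma mean_stein (f : nat -> R) :
  mean (fun s => ((W s)%:R - mu) * f (W s)) =
  mean (fun s => T s * (f (W s).+1 - f (W s))).
Proof.
rewrite /mean; congr (_ / _).
have -> : \sum_s ((W s)%:R - mu) * f (W s) =
    2^-1 * \sum_(s : 'S_n.+1) ((descents s)%:R *+ 2 - n%:R) * f (descents s).
  by rewrite mulr_sumr; apply: eq_bigr => s _; rewrite /mu /W; field.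
rewrite -stein_identity mulr_sumr; apply: eq_bigr => s _.
by rewrite /T /W; field.
Qed.

Lemma variance_descents : mean (fun s => ((W s)%:R - mu) ^+ 2) = s2.
Proof.
transitivity (mean T); last exact: mean_half_double_ascents.
under eq_mean => s do rewrite expr2.
rewrite (mean_stein (fun w => w%:R - mu)); apply: eq_mean => s.
by rewrite -natr1; ring.
Qed.

(** E|X| <= c for c the standard deviation of X, by the inequality
2 c |x| <= x ^ 2 + c ^ 2. *)
Lemma mean_dev_half_double_ascents :
  mean (fun s => `|T s - s2|) <= Num.sqrt (23 * (n%:R + 2) / 720).
Proof.
set v := 23 * (n%:R + 2) / 720; set c := Num.sqrt v.
have v0 : 0 < v by have : 0 <= n%:R :> R by []; rewrite /v; lra.
have c0 : 0 < c by rewrite sqrtr_gt0.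
have cc : c ^+ 2 = v by rewrite sqr_sqrtr // ltW.
have amgm s : `|T s - s2| <= (2 * c)^-1 * (T s - s2) ^+ 2 + c / 2.
  rewrite -(real_normK (num_real (T s - s2))).
  set x := `|_|; rewrite -subr_ge0.
  rewrite (_ : _ - _ = (2 * c)^-1 * (x - c) ^+ 2); last by field; rewrite lt0r_neq0.
  by rewrite mulr_ge0 ?sqr_ge0 // invr_ge0 mulr_ge0 // ltW.
apply: le_trans (le_mean amgm) _.
rewrite meanD meanZ mean_cst variance_half_double_ascents // -/v -cc.
by rewrite le_eqVlt; apply/orP; left; apply/eqP; field; rewrite lt0r_neq0.
Qed.

(** The error terms collected in [stein_bound], with l = lam, x = s2 and c the
standard deviation of T: one unit of the 2 bounds l - x, the other one comes from
Chebyshev's inequality. *)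
Lemma stein_error (x l c : R) : 0 < x -> x <= l -> l <= x + 1 -> 0 <= c ->
  l^-1 * ((l - x) + c) + l ^- 2 * x <= x^-1 * (c + 2).
Proof.
move=> x0 xl lx c0; have l0 : 0 < l by apply: lt_le_trans xl.
have li : l^-1 <= x^-1 by rewrite lef_pV2.
have i0 : 0 <= l^-1 by rewrite invr_ge0 ltW.
have -> : x^-1 * (c + 2) = x^-1 * (1 + c) + x^-1 by ring.
apply: lerD.
  apply: ler_pM => //; last by rewrite lerD2r lerBlDl.
  by apply: addr_ge0 => //; rewrite subr_ge0.
rewrite mulrC ler_pdivrMr ?exprn_gt0 // mulrC ler_pdivlMr // -expr2.
by rewrite ler_sqr // nnegrE ltW.
Qed.

(** The solution g is read at w - m, truncated to 0 for w < m.  There the Stein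
equation fails and its defect, at most 1, is dominated by
(w - mu) ^ 2 / lam ^ 2, because mu - w >= lam. *)
Lemma stein_bound (lam : R) (m N : nat) (A : pred nat) :
  mu = m%:R + lam -> s2 <= lam <= s2 + 1 -> (forall k, A (k + m)%N -> (k < N)%N) ->
  mean (fun s => (A (W s))%:R) - \sum_(i < N | A (i + m)%N) poisson_pmf lam i <=
  Num.sqrt (23 / 5) * (1 / Num.sqrt (n%:R + 2)) + 24 / (n%:R + 2).
Proof.
move=> muE /andP[lam_ge lam_le] AN.
have n0 : 0 <= n%:R :> R by [].
have s20 : 0 < s2 by rewrite /s2; lra.
have lam0 : 0 < lam by apply: lt_le_trans lam_ge.
pose A' := fun k => A (k + m)%N.
rewrite -/(poisson_mass lam A' N).
set q := poisson_mass lam A' N.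
pose g := stein_solution lam A' N; pose f w := g (w - m)%N.
have q0 : 0 <= q by apply: sumr_ge0 => i _; apply: poisson_pmf_ge0.
have pointwise s : (A (W s))%:R - q <=
    lam * (f (W s).+1 - f (W s)) - ((W s)%:R - mu) * f (W s)
    + lam ^- 2 * ((W s)%:R - mu) ^+ 2.
  have [mw|wm] := leqP m (W s).
    have := stein_equation lam0 A' N (W s - m)%N.
    rewrite -/q -/g /A' subnK // => eqn.
    have nn : 0 <= lam ^- 2 * ((W s)%:R - mu) ^+ 2.
      by rewrite mulr_ge0 ?sqr_ge0 // invr_ge0 sqr_ge0.
    rewrite /f subSn //; move: eqn; rewrite natrB //.
    set x := g (W s - m).+1; set y := g _ => <-.
    by rewrite muE in nn *; lra.
  have -> : f (W s).+1 = 0 by rewrite /f (_ : _ - _ = 0)%N //; lia.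
  have -> : f (W s) = 0 by rewrite /f (_ : _ - _ = 0)%N //; lia.
  rewrite subrr !mulr0 subrr add0r.
  have lw : lam <= mu - (W s)%:R by rewrite muE; have := wm; rewrite -(ltr_nat R); lra.
  have : 1 <= lam ^- 2 * ((W s)%:R - mu) ^+ 2.
    rewrite mulrC ler_pdivlMr ?exprn_gt0 // mul1r -[leRHS]sqrrN opprB.
    by rewrite ler_sqr ?nnegrE ?(le_trans (ltW lam0) lw) // ltW.
  by case: (A _) => /=; lra.
have lip s : (lam - T s) * (f (W s).+1 - f (W s)) <=
    lam^-1 * ((lam - s2) + `|T s - s2|).
  apply: le_trans (ler_norm _) _; rewrite normrM mulrC.
  have d : `|f (W s).+1 - f (W s)| <= lam^-1.
    rewrite /f; have [mw|wm] := leqP m (W s).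
      by rewrite subSn //; apply: stein_solution_lipschitz.
    rewrite (_ : (W s).+1 - m = 0)%N; last by lia.
    rewrite (_ : W s - m = 0)%N; last by lia.
    by rewrite subrr normr0 invr_ge0 ltW.
  apply: ler_pM => //.
  rewrite (_ : lam - T s = (lam - s2) - (T s - s2)); last by ring.
  apply: le_trans (ler_normB _ _) _.
  by rewrite ger0_norm // subr_ge0.
have step1 : mean (fun s => (A (W s))%:R) - q <=
    mean (fun s => (lam - T s) * (f (W s).+1 - f (W s))) + lam ^- 2 * s2.
  rewrite -[X in _ + _ * X]variance_descents -meanZ -meanD.
  rewrite -[X in _ - X](mean_cst n.+1 q) -[- mean _]mulN1r -meanZ -meanD.
  have -> : mean (fun s => (lam - T s) * (f (W s).+1 - f (W s)) +
      lam ^- 2 * ((W s)%:R - mu) ^+ 2) =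
     mean (fun s => lam * (f (W s).+1 - f (W s)) - ((W s)%:R - mu) * f (W s)
        + lam ^- 2 * ((W s)%:R - mu) ^+ 2).
    rewrite !meanD; congr (_ + _).
    have -> : mean (fun s => - (((W s)%:R - mu) * f (W s))) =
       mean (fun s => - (T s * (f (W s).+1 - f (W s)))).
      under eq_mean => s do rewrite -mulN1r.
      by rewrite meanZ mean_stein -meanZ; apply: eq_mean => s; rewrite mulN1r.
    by rewrite -meanD; apply: eq_mean => s; ring.
  by apply: le_mean => s; rewrite mulN1r.
apply: le_trans step1 _.
have step2 : mean (fun s => (lam - T s) * (f (W s).+1 - f (W s))) <=
    lam^-1 * ((lam - s2) + Num.sqrt (23 * (n%:R + 2) / 720)).
  apply: le_trans (le_mean lip) _; rewrite meanZ meanD mean_cst.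
  by rewrite ler_pM2l ?invr_gt0 // lerD2l mean_dev_half_double_ascents.
apply: le_trans (lerD step2 (lexx _)) _.
apply: le_trans (stein_error s20 lam_ge lam_le (sqrtr_ge0 _)) _.
have Ne : n%:R + 2 != 0 :> R by apply: lt0r_neq0; lra.
rewrite (_ : _ * _ = s2^-1 * Num.sqrt (23 * (n%:R + 2) / 720) + 24 / (n%:R + 2)); last first.
  by rewrite /s2; field.
rewrite lerD2r (_ : 23 * (n%:R + 2) / 720 = (12^-1) ^+ 2 * ((23 / 5) * (n%:R + 2))); last by field.
rewrite sqrtrM ?sqr_ge0 // sqrtr_sqr ger0_norm // sqrtrM //.
have rr : Num.sqrt (n%:R + 2) ^+ 2 = n%:R + 2 :> R by rewrite sqr_sqrtr //; lra.
have r0 : Num.sqrt (n%:R + 2) != 0 :> R by rewrite lt0r_neq0 // sqrtr_gt0; lra.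
rewrite /s2; move: rr r0; move: (Num.sqrt (n%:R + 2)) => r <- r0.
by rewrite le_eqVlt; apply/orP; left; apply/eqP; field.
Qed.
End SteinBound.

(** * Total variation distance *)

Lemma measure_seq (R : realType) (d : measure_display) (T : measurableType d)
    (mu : {measure set T -> \bar R}) (r : seq T) :
  (forall x : T, measurable [set x]) -> uniq r ->
  mu [set` r] = (\sum_(x <- r) mu [set x])%E.
Proof.
move=> m1 ur; have -> : [set` r] = \bigcup_(x in [set` r]) [set x].
  by apply/seteqP; split => x /=; [move=> xr; exists x|case=> y /= yr ->].
rewrite measure_fin_bigcup // -?fsbig_seq //; first exact: finite_seq.
by move=> x y _ _ [z [/= -> ->]].
Qed.

Lemma esum_probability_le1 (R : realType) (Q : probability int R) :
  (\esum_(x in [set: int]) Q [set x] <= 1)%E.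
Proof.
apply: ge_ereal_sup => _ [A [Afin _] <-].
rewrite fsbig_finite //= -measure_seq //; last exact: finmap.fset_uniq.
exact: probability_le1.
Qed.

(** The terms of |P - Q| outside the support of P sum up to at most the mass that Q
leaves there, so the distance is attained at the set of the k < N with
Q k < P k. *)
Lemma dTV_le (R : realType) (P Q : probability int R) (p : nat -> R) (N : nat) (B : R) :
  (forall k, (k < N)%N -> P [set k%:Z] = (p k)%:E) ->
  (forall x, ~ (Posz @` `I_N) x -> P [set x] = 0%E) ->
  \sum_(k < N) p k = 1 ->
  (forall A : pred nat,
     \sum_(k < N | A k) (p k - fine (Q [set k%:Z])) <= B) ->
  (dTV P Q <= B%:E)%E.
Proof.
move=> Pp P0 p1 leB; pose q k := fine (Q [set k%:Z]).
have Qq k : Q [set k%:Z] = (q k)%:E by rewrite fineK // fin_num_measure.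
have sumS (f : int -> \bar R) (g : nat -> R) :
    (forall x, 0 <= f x)%E -> (forall k, (k < N)%N -> f k%:Z = (g k)%:E) ->
    (\esum_(x in [set: int] `&` Posz @` `I_N) f x = (\sum_(k < N) g k)%:E)%E.
  move=> f0 fg; rewrite setTI esum_image; last by move=> x y _ _ [].
  rewrite esum_fset // -fsbig_ord -sumEFin.
  by apply: eq_bigr => k _; apply: fg.
set S := Posz @` `I_N.
have tail : (\esum_(x in [set: int] `&` ~` S) `|P [set x] - Q [set x]| <=
    (1 - \sum_(k < N) q k)%:E)%E.
  rewrite (eq_esum (b := fun x => Q [set x])); last first.
    by move=> x [_ Sx]; rewrite P0 // sub0e abseN gee0_abs.
  have := esum_probability_le1 Q.
  rewrite (esumID S) // (sumS _ q) // => h.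
  by rewrite EFinB leeBrDl.
rewrite /dTV (esumID S) //.
rewrite (sumS _ (fun k => `|p k - q k|)) //; last first.
  by move=> k kN; rewrite Pp // Qq -EFinB abse_EFin.
apply: (@le_trans _ _ ((2^-1)%:E * (\sum_(k < N) `|p k - q k| + (1 - \sum_(k < N) q k))%:E)%E).
  by rewrite lee_pmul2l // EFinD leeD2l.
have -> : 1 - \sum_(k < N) q k = \sum_(k < N) (p k - q k) by rewrite sumrB p1.
rewrite -EFinM lee_fin -big_split /=.
apply: le_trans (leB (fun k => q k < p k)).
rewrite mulrC ler_pdivrMr // mulr_suml [leRHS]big_mkcond /=.
apply: ler_sum => k _; rewrite -/(q k).
case: ltP => h; first by rewrite gtr0_norm ?subr_gt0 //; lra.
by rewrite ler0_norm ?subr_le0 //; lra.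
Qed.

(** Inversion is a bijection of the symmetric group, so W has the law of the number
of descents itself. *)
Lemma law_inv_descents (R : realType) (n : nat) (d : measure_display)
    (Omega : measurableType d) (P : probability Omega R)
    (pi : {RV P >-> 'S_n}) (x : int) :
  uniform_permutation pi ->
  distribution P (@inv_descents n \o pi : {RV P >-> int}) [set x] =
  (mean (fun s : 'S_n => ((descents s)%:Z == x)%:R))%:E.
Proof.
move=> unif.
pose r := [seq s <- enum 'S_n | inv_descents s == x].
transitivity (distribution P pi [set` r]).
  rewrite /distribution /pushforward; congr (P _).
  by apply/seteqP; split => w /=; rewrite mem_filter mem_enum andbT; [move=> ->|move/eqP].
have ur : uniq r by apply/filter_uniq/enum_uniq.
rewrite measure_seq //.
rewrite (eq_bigr (fun=> ((n`!)%:R^-1)%:E)) => [|s _]; last exact: unif.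
rewrite sumEFin /mean mulr_suml big_filter big_enum_cond /=; congr (_%:E).
rewrite [RHS](reindex_inj invg_inj) /= big_mkcond /=.
apply: eq_bigr => s _; rewrite /inv_descents; by case: eqP => _ /=; rewrite ?mul1r ?mul0r.
Qed.

Lemma translated_poisson_atom (R : realType) (mu s2 : R) (Q : probability int R)
    (m k : nat) :
  0 < s2 + frac_part (mu - s2) -> translated_poisson mu s2 Q ->
  Num.floor (mu - s2) = m%:Z ->
  Q [set (k + m)%N%:Z] = (poisson_pmf (s2 + frac_part (mu - s2)) k)%:E.
Proof.
move=> lam0 tp fl; have := tp [set k%:R] (measurable_set1 _).
rewrite /pushforward.
have -> : (fun y : int => y%:~R - mu + s2 + frac_part (mu - s2)) @^-1` [set k%:R] =
    [set (k + m)%N%:Z].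
  have e (y : int) : y%:~R - mu + s2 + frac_part (mu - s2) = (y - m%:Z)%:~R.
    by rewrite /frac_part fl rmorphB /=; ring.
  apply/seteqP; split => y /=; rewrite e.
    by move/eqP; rewrite pmulrn eqr_int subr_eq => /eqP ->; rewrite PoszD.
  by move=> ->; rewrite PoszD addrK.
move=> ->; rewrite (_ : _ @^-1` _ = [set k]).
  by rewrite /poisson_prob lam0 esum_set1 // lee_fin poisson_pmf_ge0.
by apply/seteqP; split => y /=; [move/eqP; rewrite eqr_nat => /eqP|move=> ->].
Qed.

Lemma descents_lt (n : nat) (s : 'S_n.+1) : (descents s < n.+1)%N.
Proof.
have := descents_falls s; rewrite big_ord_recl fall0 add0n => e.
by rewrite e -[leqRHS]card_ord -sum1_card; apply: leq_sum => i _; apply: leq_b1.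
Qed.

Lemma sum_mean_descents (R : realFieldType) (n : nat) (A : pred nat) :
  \sum_(k < n.+1 | A k) mean (fun s : 'S_n.+1 => ((descents s)%:Z == k%:Z)%:R) =
  mean (fun s : 'S_n.+1 => (A (descents s))%:R) :> R.
Proof.
rewrite -mean_sum; apply: eq_mean => s.
rewrite big_mkcond (bigD1 (Ordinal (descents_lt s))) //= eqxx big1 ?addr0 //.
  by case: (A _).
move=> k; rewrite -val_eqE /= eq_sym => /negPf kd; rewrite eqz_nat kd.
by case: (A _).
Qed.

Theorem theorem2p5 (R : realType) (n : nat) (d : measure_display)
    (Omega : measurableType d) (P : probability Omega R)
    (pi : {RV P >-> 'S_n}) (TP : probability int R) :
  let mu : R := (n%:R - 1) / 2 in
  let s2 : R := (n%:R + 1) / 12 in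
  let W : {RV P >-> int} := @inv_descents n \o pi in
  (6 <= n)%N ->
  uniform_permutation pi ->
  translated_poisson mu s2 TP ->
  (dTV (distribution P W) TP <=
     (Num.sqrt (23 / 5) * (1 / Num.sqrt (n%:R + 1)) + 24 / (n%:R + 1))%:E)%E.
Proof.
case: n pi => [|n] pi mu s2 W n6 unif tp; first by [].
have n1 : n.+1%:R + 1 = n%:R + 2 :> R by rewrite -natr1; ring.
have muE : mu = n%:R / 2 by rewrite /mu -natr1 addrK.
have s2E : s2 = (n%:R + 2) / 12 by rewrite /s2 n1.
have n5 : 5 <= n%:R :> R by rewrite (ler_nat R 5).
have d0 : 0 <= mu - s2 by rewrite muE s2E; lra.
have [m mE] : exists m : nat, Num.floor (mu - s2) = m%:Z.
  by exists `|Num.floor (mu - s2)|%N; rewrite gez0_abs // floor_ge0.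
pose gamma := frac_part (mu - s2).
have g0 : 0 <= gamma by rewrite subr_ge0 floor_le.
have g1 : gamma <= 1.
  have : mu - s2 < (m%:Z + 1)%:~R by rewrite -floor_lt_int mE ltrDl.
  by rewrite /gamma /frac_part mE rmorphD /= => h; rewrite lerBlDl addrC ltW // addrC.
pose lam := s2 + gamma.
have mulam : mu = m%:R + lam by rewrite /lam /gamma /frac_part mE; ring.
have s20 : 0 < s2 by rewrite s2E; lra.
have lam0 : 0 < lam by rewrite ltr_wpDr.
have mn : (m <= n.+1)%N.
  by rewrite -(ler_nat R) -natr1; move: mulam; rewrite muE; lra.
rewrite n1.
apply: (dTV_le (N := n.+1) (p := fun k =>
    mean (fun s : 'S_n.+1 => ((descents s)%:Z == k%:Z)%:R))).
- by move=> k _; apply: law_inv_descents.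
- move=> x xN; rewrite [LHS](law_inv_descents x unif); congr (_%:E).
  rewrite -[RHS](mean_cst n.+1 0); apply: eq_mean => s.
  case: eqP => // e; case: xN; exists (descents s) => //=; exact: descents_lt.
- by rewrite (sum_mean_descents R n predT) mean_cst.
move=> A; rewrite sumrB sum_mean_descents.
pose A' k := A k && (k < n.+1)%N.
have -> : mean (fun s : 'S_n.+1 => (A (descents s))%:R) =
    mean (fun s : 'S_n.+1 => (A' (descents s))%:R) :> R.
  by apply: eq_mean => s; rewrite /A' descents_lt andbT.
have A'N k : A' (k + m)%N -> (k < n.+1 - m)%N by move=> /andP[_]; lia.
have muE' : n%:R / 2 = m%:R + lam :> R by rewrite -muE.
have lamb : (n%:R + 2) / 12 <= lam <= (n%:R + 2) / 12 + 1.
  by rewrite -s2E /lam lerDl g0 lerD2l.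
have n3 : (3 <= n)%N by lia.
apply: le_trans (stein_bound n3 muE' lamb A'N).
rewrite lerD2l lerN2.
rewrite -(big_mkord (fun k => A k) (fun k => fine (TP [set k%:Z]))).
rewrite (@big_cat_nat _ _ _ m) //=.
(* The atoms of the translated law below m are bounded below by 0. *)
rewrite -[leLHS]add0r lerD //.
  by apply: sumr_ge0 => k _; apply: fine_ge0.
rewrite -[in leRHS](add0n m) big_addn big_mkord.
rewrite le_eqVlt; apply/orP; left; apply/eqP.
apply: eq_big => [i|i _]; first by rewrite /A' addnC -ltn_subRL ltn_ord andbT.
by rewrite (translated_poisson_atom (m := m) i lam0 tp mE).
Qed.
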